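(* Let $(H,\|\cdot\|_H)$ be a Banach space and let $\{X_t(x):\ x\in[0,1]^d,\ t\in[0,1]\}$ be an $H$-valued stochastic field on a probability space $(\Omega,\mathcal F,\mathbb P)$. Let $\gamma>0$ and $\beta$ be real numbers such that $\beta>\gamma$ if $\gamma\ge1$ and $\beta>1/\gamma$ if $\gamma<1$. Let $$\varphi(r)=\begin{cases}(-\log r)^{-\beta}, & 0<r\le\tfrac12,\\ f(r), & r>\tfrac12,\end{cases}$$ where $f$ is an arbitrary nondecreasing continuous function on $[1/2,+\infty)$ with $f(\tfrac12)=(\log2)^{-\beta}$. Suppose that there is a constant $C>0$ such that $$\mathbb E\Big[\sup_{0\le t\le 1}\|X_t(x)-X_t(y)\|_H^\gamma\Big]\le C|x-y|^d\varphi(|x-y|),\qquad x,y\in[0,1]^d.$$ Let $\vartheta$ satisfy $1/\beta<\vartheta<1/\gamma$ if $\gamma\ge1$, and $1/(\beta\gamma)<\vartheta<1/\gamma$ if $\gamma<1$. Then there is a realization $\tilde X$ of $X$ such that $\tilde X$ is continuous in $x$ and, for every $\alpha\in(0,1/\gamma-\vartheta]$, $$\mathbb E\Big[\sup_{0\le t\le1}[\tilde X_t(\cdot)]_{\alpha,\varphi}^\gamma\Big]<+\infty,\quad\text{where}\quad [\tilde X_t(\cdot)]_{\alpha,\varphi}:=\sup\Big\{\frac{\|\tilde X_t(x)-\tilde X_t(y)\|_H}{\varphi(|x-y|)^\alpha}:\ x,y\in[0,1]^d,\ x\ne y\Big\}.$$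
   Context: Here $d\ge1$ is an integer and $|\cdot|$ is the Euclidean norm on $\mathbb R^d$; $\varphi(0)$ is read as $0$. A realization $\tilde X$ of $X$ is an $H$-valued stochastic field on the same probability space and with the same index set such that, for each $x\in[0,1]^d$, $\mathbb P\{\tilde X_t(x)=X_t(x)\text{ for all }t\in[0,1]\}=1$. ''Continuous in $x$'' means that for almost every $\omega$, for every $t\in[0,1]$, the map $x\mapsto\tilde X_t(x,\omega)$ is continuous on $[0,1]^d$. Writing the expectation of a supremum over $t$ presupposes that this supremum is a random variable. *)

(* Defs.v *)
From HB Require Import structures.
From mathcomp Require Import all_boot all_order all_algebra.
From mathcomp Require Import all_classical all_reals all_analysis.
From mathcomp Require Import measurable_realfun.

Set Implicit Arguments.
Unset Strict Implicit.
Unset Printing Implicit Defensive.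

Import Order.TTheory GRing.Theory Num.Theory.
Import numFieldNormedType.Exports.

Local Open Scope classical_set_scope.
Local Open Scope ring_scope.

Section Definitions.
Context {R : realType}.

Definition unit_cube (d : nat) : set 'rV[R]_d :=
  [set x | forall i, 0 <= x ord0 i <= 1].

(* The library norm on 'rV[R]_d is the sup norm, hence this one. *)
Definition enorm (d : nat) (x : 'rV[R]_d) : R :=
  Num.sqrt (\sum_(i < d) x ord0 i ^+ 2).

Definition phi (beta : R) (f : R -> R) (r : R) : R :=
  if r <= 0 then 0 else if r <= 1 / 2 then (- ln r) `^ (- beta) else f r.

(* Fields are total functions of the indices; only their values at
   t in [0, 1] and x in the unit cube are ever considered. *)

Definition sup_time {Omega : Type} (F : R -> Omega -> \bar R) (w : Omega) :
    \bar R :=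
  ereal_sup [set F t w | t in `[0, 1]].

Section Field.
Context {disp : measure_display} {Omega : measurableType disp}.
Context {H : completeNormedModType R} {d : nat}.

(* H carries its Borel sigma-algebra. *)
Definition stochastic_field (X : R -> 'rV[R]_d -> Omega -> H) : Prop :=
  forall t x, t \in `[0, 1] -> unit_cube x ->
    measurable_fun [set: Omega]
      (X t x : Omega -> g_sigma_algebraType (@open H)).

(* As measures are only meaningful on measurable sets, "P E = 1" includes
   the measurability of E. *)
Definition realization (P : probability Omega R)
    (X Xt : R -> 'rV[R]_d -> Omega -> H) : Prop :=
  stochastic_field Xt /\
  forall x, unit_cube x ->
    let E := [set w | forall t, t \in `[0, 1] -> Xt t x w = X t x w] in
    measurable E /\ P E = 1%E.

Definition continuous_in_space (P : probability Omega R)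
    (X : R -> 'rV[R]_d -> Omega -> H) : Prop :=
  {ae P, forall w, forall t, t \in `[0, 1] ->
    {within @unit_cube d, continuous (fun x => X t x w)}}.

End Field.

Definition holder_seminorm {H : completeNormedModType R} {d : nat}
    (alpha : R) (g : R -> R) (u : 'rV[R]_d -> H) : \bar R :=
  ereal_sup [set e | exists x y, [/\ unit_cube x, unit_cube y, x != y &
    e = (`|u x - u y| / g (enorm (x - y)) `^ alpha)%:E]].

End Definitions.

Arguments unit_cube {R d}.

(* Main.v *)
Require Import Defs.
From HB Require Import structures.
From mathcomp Require Import all_boot all_order all_algebra.
From mathcomp Require Import all_classical all_reals all_analysis.
From mathcomp Require Import measurable_realfun.
From mathcomp Require Import ring lra zify.

Import Order.TTheory GRing.Theory Num.Theory.
Import numFieldNormedType.Exports.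

Local Open Scope classical_set_scope.
Local Open Scope ring_scope.

(** Kolmogorov-Chentsov chaining along dyadic grids. Let [G_n] be the sum of
    [sup_t |X_t(p) - X_t(q)|^gamma] over neighbouring points [p], [q] of the
    grid of mesh [2^-n]. The factor [|p - q|^d] cancels the number of such
    pairs, so [E G_n = O(n^(- beta))], and hence [A = sum_n n^e G_n] is
    integrable as soon as [e - beta < -1]. Hoelder's inequality (subadditivity
    of [z^gamma] if [gamma < 1]) turns [A < oo] into a bound on
    [sum_n n^(alpha beta) G_n^(1/gamma)] for [alpha = 1/gamma - theta]; the
    conditions on [beta] and [theta] say precisely that a suitable [e] exists.
    Since [phi(2^-n)^alpha] is of order [n^(- alpha beta)], the telescoping sum
    over grid approximations of [x] and [y] is at most
    [C A^(1/gamma) phi(|x - y|)^alpha], so the limit along grid approximations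
    is the required realization. *)

(** * Power sums and Hoelder weights *)

Section PowerSums.
Context {R : realType}.
Implicit Types (a b d g x k B : R).

(** Divided by [(x + 1)^(-d)], this is [1 + d / (x + 1) <= (x / (x + 1))^(-d)], which follows from
    [ln (1 + y) <= y] and [1 + y <= exp y]. *)
Lemma powR_telescope x d : 0 < x -> 0 < d ->
  d * (x + 1) `^ (- (1 + d)) <= x `^ (- d) - (x + 1) `^ (- d).
Proof.
move=> x0 d0; have x1 : 0 < x + 1 by lra.
have e1 : (x + 1) `^ (- (1 + d)) = (x + 1) `^ (- d) / (x + 1).
  rewrite (_ : - (1 + d) = - d + - 1); last by ring.
  by rewrite powRD ?(gt_eqF x1) ?implybT// powR_inv1 // ltW.
have e2 : x `^ (- d) = (x + 1) `^ (- d) * (x / (x + 1)) `^ (- d).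
  by rewrite -powRM ?divr_ge0 ?ltW// mulrC divfK // gt_eqF.
have q0 : 0 < x / (x + 1) by rewrite divr_gt0.
have l1 : ln (x / (x + 1)) <= - (x + 1)^-1.
  rewrite (_ : x / (x + 1) = 1 + (- (x + 1)^-1)); last by field; rewrite gt_eqF.
  apply: le_ln1Dx; rewrite ltrN2 invf_lt1 //; lra.
have l2 : 1 + d / (x + 1) <= (x / (x + 1)) `^ (- d).
  rewrite /powR (gt_eqF q0); apply: le_trans (expR_ge1Dx _).
  by rewrite lerD2l mulNr -mulrN ler_pM2l// lerNr.
have p0 : 0 < (x + 1) `^ (- d) by rewrite powR_gt0.
rewrite e1 e2 -[X in _ <= _ - X]mulr1 -mulrBr mulrCA (ler_pM2l p0).
by rewrite lerBrDl.
Qed.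

Lemma sum_powR_le d N : 0 < d ->
  \sum_(n < N) n.+1%:R `^ (- (1 + d)) <= 1 + d^-1.
Proof.
move=> d0; case: N => [|N]; first by rewrite big_ord0 addr_ge0 ?invr_ge0 ?ltW.
(* Carrying the subtracted remainder makes the induction telescope. *)
suff : \sum_(n < N.+1) n.+1%:R `^ (- (1 + d)) <=
       1 + d^-1 - d^-1 * N.+1%:R `^ (- d).
  by move=> /le_trans; apply; rewrite gerBl mulr_ge0 ?invr_ge0 ?powR_ge0 ?ltW.
elim: N => [|N IH]; first by rewrite big_ord1 !powR1 /=; lra.
rewrite big_ord_recr /=.
have := @powR_telescope N.+1%:R d (ltr0Sn _ _) d0; rewrite natr1.
rewrite -ler_pdivlMl// mulrBr => h; lra.
Qed.

(** Hoelder's inequality by truncation at the level [L * s], with [s = (n + 1)^(- (1 + d) - a)]. The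
    first part of the bound sums to at most [(1 + d^-1) * L], the second to at most
    [L^(1 - g) * B = L]. *)
Lemma hoelder_weight_ge1 g a d (k : nat -> R) B : 1 <= g -> 0 < d ->
  (forall n, 0 <= k n) -> 0 < B ->
  (forall N, \sum_(n < N) n.+1%:R `^ ((1 + d) * (g - 1) + a * g) * k n `^ g <= B) ->
  forall N, \sum_(n < N) n.+1%:R `^ a * k n <= (2 + d^-1) * B `^ g^-1.
Proof.
move=> g1 d0 k0 B0 hB N; set L := B `^ g^-1.
have L0 : 0 < L by rewrite powR_gt0.
have g0 : 0 < g by lra.
have LB : L `^ (1 - g) * B = L.
  have -> : B = L `^ g by rewrite -powRrM mulVf ?gt_eqF// powRr1 // ltW.
  rewrite -powRD ?(gt_eqF L0) ?implybT// subrK powRr1 //; exact: ltW.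
have key n : n.+1%:R `^ a * k n <= L * n.+1%:R `^ (- (1 + d)) +
    L `^ (1 - g) * (n.+1%:R `^ ((1 + d) * (g - 1) + a * g) * k n `^ g).
  have n0 : 0 < n.+1%:R :> R by rewrite ltr0Sn.
  set s : R := n.+1%:R `^ (- (1 + d) - a).
  have s0 : 0 < s by rewrite powR_gt0.
  have Ls0 : 0 < L * s by rewrite mulr_gt0.
  (* either [k n <= L s], or [k n = (k n)^(1-g) (k n)^g <= (L s)^(1-g) (k n)^g] *)
  have h : k n <= L * s + (L * s) `^ (1 - g) * k n `^ g.
    have [h|h] := leP (k n) (L * s).
      by rewrite (le_trans h)// lerDl mulr_ge0 ?powR_ge0.
    have kn0 : 0 < k n by apply: lt_trans h.
    apply: (@le_trans _ _ (k n `^ (1 - g) * k n `^ g)).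
      by rewrite -powRD ?(gt_eqF kn0) ?implybT// subrK powRr1.
    rewrite -[leLHS]add0r lerD ?(ltW Ls0)// ler_wpM2r ?powR_ge0//.
    rewrite -opprB !powRN lef_pV2 ?posrE ?powR_gt0//.
    by apply: ge0_ler_powR; rewrite ?nnegrE; lra.
  apply: (le_trans (ler_wpM2l (powR_ge0 _ a) h)).
  rewrite mulrDr powRM ?(ltW L0) ?(ltW s0)//.
  have eqle u v : u = v -> u <= v by move=> ->.
  apply: eqle; congr (_ + _).
    rewrite mulrCA -powRD ?(gt_eqF n0) ?implybT//; congr (_ * _ `^ _); ring.
  rewrite /s -powRrM mulrA (mulrCA (n.+1%:R `^ _)) -!mulrA; congr (_ * _).
  rewrite mulrA -powRD ?(gt_eqF n0) ?implybT//; congr (_ `^ _ * _); ring.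
apply: (le_trans (ler_sum _ (fun (n : 'I_N) _ => key n))).
rewrite big_split -!mulr_sumr /=.
have := ler_wpM2l (ltW L0) (@sum_powR_le d N d0).
have := ler_wpM2l (powR_ge0 L (1 - g)) (hB N).
rewrite LB; lra.
Qed.

(** A single term [z] satisfies [z^g <= B], so [z <= L] and
    [z = z^(1 - g) * z^g <= L^(1 - g) * z^g]. Summing yields [L^(1 - g) * B = L]. *)
Lemma hoelder_weight_lt1 g a (k : nat -> R) B : 0 < g <= 1 ->
  (forall n, 0 <= k n) -> 0 < B ->
  (forall N, \sum_(n < N) n.+1%:R `^ (a * g) * k n `^ g <= B) ->
  forall N, \sum_(n < N) n.+1%:R `^ a * k n <= B `^ g^-1.
Proof.
move=> /andP[g0 g1] k0 B0 hB N; set L := B `^ g^-1.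
have L0 : 0 < L by rewrite powR_gt0.
have LB : L `^ g = B by rewrite -powRrM mulVf ?gt_eqF// powRr1 // ltW.
have LBL : L `^ (1 - g) * B = L.
  rewrite -{1}LB -powRD ?(gt_eqF L0) ?implybT// subrK powRr1 //; exact: ltW.
have key (n : 'I_N) : n.+1%:R `^ a * k n <=
    L `^ (1 - g) * (n.+1%:R `^ (a * g) * k n `^ g).
  set z := n.+1%:R `^ a * k n.
  have z0 : 0 <= z by rewrite mulr_ge0 ?powR_ge0.
  have zg : n.+1%:R `^ (a * g) * k n `^ g = z `^ g.
    by rewrite powRM ?powR_ge0// -powRrM.
  rewrite zg; move: z0; rewrite le_eqVlt => /orP[/eqP <-|z0].
    by rewrite mulr_ge0 ?powR_ge0.
  have zL : z <= L.
    have : z `^ g <= L `^ g.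
      rewrite LB (le_trans _ (hB N))// (bigD1 n)//= zg lerDl sumr_ge0// => i _.
      by rewrite mulr_ge0 ?powR_ge0.
    move=> /(ge0_ler_powR (r := g^-1)).
    rewrite !nnegrE !powR_ge0 invr_ge0 (ltW g0) => /(_ isT isT isT).
    by rewrite -(powRrM z) -(powRrM L) mulfV ?gt_eqF// !powRr1 ?(ltW z0) ?(ltW L0).
  apply: (@le_trans _ _ (z `^ (1 - g) * z `^ g)).
    by rewrite -powRD ?(gt_eqF z0) ?implybT// subrK powRr1 // ltW.
  by rewrite ler_wpM2r ?powR_ge0//; apply: ge0_ler_powR; rewrite ?nnegrE; lra.
apply: (le_trans (ler_sum _ (fun (n : 'I_N) _ => key n))).
rewrite -mulr_sumr -[leRHS]LBL ler_wpM2l ?powR_ge0//.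
exact: hB.
Qed.

(* The two ranges of [beta] and [theta] are exactly what makes a weight
   [(n + 1)^e] available that is both strong enough for Hoelder's inequality
   and summable against [(n + 1)^(- beta)]. *)
Lemma exists_hoelder_weight g b th : 0 < g ->
  (1 <= g -> g < b) -> (g < 1 -> 1 / g < b) ->
  (1 <= g -> 1 / b < th < 1 / g) -> (g < 1 -> 1 / (b * g) < th < 1 / g) ->
  exists e K : R, [/\ e - b < - 1, 0 < K &
    forall (k : nat -> R) B, (forall n, 0 <= k n) -> 0 < B ->
    (forall N, \sum_(n < N) n.+1%:R `^ e * k n `^ g <= B) ->
    forall N, \sum_(n < N) n.+1%:R `^ ((1 / g - th) * b) * k n <= K * B `^ g^-1].
Proof.
move=> g0 b1 b2 th1 th2; have [gl1|gge1] := ltP g 1.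
  have {b2} hb := b2 gl1; have /andP[hth _] := th2 gl1.
  have b0 : 0 < b by rewrite (lt_trans _ hb)// divr_gt0.
  (* Here [e - b = - (th * b * g)], which is below [-1] because [1 / (b * g) < th]. *)
  exists ((1 / g - th) * b * g), 1; split => //.
    rewrite ltr_pdivrMr ?mulr_gt0// in hth.
    rewrite (_ : _ - b = - (th * (b * g))); last by field; rewrite gt_eqF.
    by rewrite ltrN2.
  move=> k B k0 B0 hB N; rewrite [leRHS]mul1r; apply: hoelder_weight_lt1 => //.
  by rewrite g0 ltW.
have {b1} hb := b1 gge1; have /andP[hth _] := th1 gge1.
have b0 : 0 < b by lra.
rewrite ltr_pdivrMr// in hth.
(* With this choice [th * b = 1 + 2 * d], and [e - b] becomes [- 1 - d * (g + 1)]. *)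
pose d := (th * b - 1) / 2.
have d0 : 0 < d by rewrite /d; lra.
exists ((1 + d) * (g - 1) + (1 / g - th) * b * g), (2 + d^-1); split.
- have -> : (1 + d) * (g - 1) + (1 / g - th) * b * g - b
     = - 1 - d * (g + 1).
    by rewrite /d; field; rewrite gt_eqF.
  by rewrite gtrBl mulr_gt0// addr_gt0.
- by rewrite addr_gt0// invr_gt0.
- by move=> k B k0 B0 hB N; exact: hoelder_weight_ge1.
Qed.

End PowerSums.

(** * The modulus phi *)

Lemma continuous_powR {R : realType} (p x : R) : 0 < x ->
  {for x, continuous (fun y => y `^ p)}.
Proof.
move=> x0; apply: differentiable_continuous; apply/derivable1_diffP.
by apply: derivable_powR; rewrite in_itv/= x0.
Qed.

Section Modulus.
Context {R : realType} {beta : R} {f : R -> R}.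
Hypotheses (beta_gt0 : 0 < beta)
  (f_mono : {in `[1 / 2, +oo[ &, {homo f : r s / r <= s}})
  (f_cont : {within `[1 / 2, +oo[, continuous f})
  (f_half : f (1 / 2) = ln 2 `^ (- beta)).
Local Notation phi := (phi beta f).
Implicit Types r s : R.

Let ln2_gt0 : 0 < ln 2 :> R. Proof. by rewrite ln_gt0// ltr1n. Qed.

Lemma ler_powRN (a b x : R) : 0 <= x -> 0 < a -> a <= b -> b `^ (- x) <= a `^ (- x).
Proof.
move=> x0 a0 ab; have b0 : 0 < b by apply: lt_le_trans ab.
rewrite !powRN lef_pV2 ?posrE ?powR_gt0// ge0_ler_powR ?nnegrE//; exact: ltW.
Qed.

Lemma phi_small r : 0 < r <= 1 / 2 -> phi r = (- ln r) `^ (- beta).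
Proof. by move=> /andP[r0 r1]; rewrite /Defs.phi leNgt r0 /= r1. Qed.

(** The endpoint is included because [f_half] makes the two branches agree there. *)
Lemma phi_large r : 1 / 2 <= r -> phi r = f r.
Proof.
rewrite le_eqVlt => /predU1P[<-|r1]; last first.
  by rewrite /Defs.phi !leNgt r1 (lt_trans _ r1).
by rewrite phi_small ?lexx ?andbT// f_half div1r lnV ?posrE// opprK.
Qed.

Let ln_half r : 0 < r -> r <= 1 / 2 -> ln 2 <= - ln r.
Proof.
move=> r0 r1; rewrite lerNr -lnV ?posrE// ler_ln ?posrE ?invr_gt0//.
by rewrite -div1r.
Qed.

Lemma phi_gt0 r : 0 < r -> 0 < phi r.
Proof.
move=> r0; have [r1|r1] := leP r (1 / 2).
  by rewrite phi_small ?r0// powR_gt0// (lt_le_trans ln2_gt0)// ln_half.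
rewrite phi_large; last exact: ltW.
apply: (@lt_le_trans _ _ (f (1 / 2))).
  by rewrite f_half powR_gt0.
by apply: f_mono; rewrite ?in_itv/= ?andbT ?lexx// ltW.
Qed.

Lemma phi_ge0 r : 0 <= phi r.
Proof.
have [r0|r0] := leP r 0; first by rewrite /Defs.phi r0.
exact/ltW/phi_gt0.
Qed.

Lemma phi_le r s : r <= s -> phi r <= phi s.
Proof.
move=> rs; have [r0|r0] := leP r 0; first by rewrite {1}/Defs.phi r0 phi_ge0.
have s0 : 0 < s by apply: lt_le_trans rs.
have [s1|s1] := leP s (1 / 2).
  have r1 := le_trans rs s1; rewrite !phi_small ?r0 ?s0//.
  apply: ler_powRN; first exact: ltW.
    by rewrite (lt_le_trans ln2_gt0)// ln_half.
  by rewrite lerN2 ler_ln ?posrE.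
rewrite (phi_large s); last exact: ltW.
have [r1|r1] := leP r (1 / 2); last first.
  rewrite phi_large; last exact: ltW.
  by apply: f_mono => //; rewrite in_itv/= andbT ltW.
apply: (@le_trans _ _ (f (1 / 2))); last first.
  by apply: f_mono; rewrite ?in_itv/= ?andbT ?lexx// ltW.
by rewrite f_half phi_small ?r0//; apply: ler_powRN; [exact: ltW| |exact: ln_half].
Qed.

Lemma phi_continuous r : 0 < r -> {for r, continuous phi}.
Proof.
move=> r0.
(* Both branches are evaluated at a clamped argument; one of them always equals [f (1 / 2)] and
   cancels, so the gluing point needs no separate treatment. *)
pose g s := (- ln (Num.min s (1 / 2))) `^ (- beta) + f (Num.max s (1 / 2)) - f (1 / 2).
have phiE s : 0 < s -> phi s = g s.
  move=> s0; rewrite /g; case: (leP s (1 / 2)) => s1.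
    by rewrite phi_small ?s0// addrK.
  rewrite -(phi_small (1 / 2)) ?lexx ?andbT// (phi_large (1 / 2))//.
  by rewrite addrAC subrr add0r phi_large// ltW.
have gr : {for r, continuous g}.
  apply: continuousB; last exact: cvg_cst.
  apply: continuousD.
    pose h s : R := Num.min s (1 / 2).
    have h0 : 0 < h r by rewrite lt_min r0 divr_gt0.
    have h1 : h r <= 1 / 2 by rewrite ge_min lexx orbT.
    have hc : {for r, continuous h}.
      by apply: continuous_min; [exact: cvg_id|exact: cvg_cst].
    have -> : (fun s => (- ln (Num.min s (1 / 2))) `^ (- beta)) =
        (fun s => s `^ (- beta)) \o (fun s => - ln (h s)) by [].
    have l0 : 0 < - ln (h r) by rewrite (lt_le_trans ln2_gt0)// ln_half.
    apply: continuous_comp.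
      apply: continuousN; apply: continuous_comp => //.
      exact: continuous_ln.
    exact: continuous_powR.
  apply/cvgrPdist_lt => e e0.
  have /subspace_continuousP/(_ (Num.max r (1 / 2))) := f_cont.
  rewrite /= in_itv/= le_max lexx orbT => /(_ isT).
  move=> /cvgrPdist_lt/(_ e e0); rewrite near_withinE => fe.
  have hc : {for r, continuous (fun s : R => Num.max s (1 / 2))}.
    by apply: continuous_max; [exact: cvg_id|exact: cvg_cst].
  apply: (@filterS _ (nbhs r) _ _ _ _ (hc _ fe)) => s; apply.
  by rewrite /= in_itv/= le_max lexx orbT.
rewrite /prop_for /continuous_at phiE//; apply: cvg_trans gr.
apply: near_eq_cvg; near=> s; rewrite phiE//; near: s.
exact: lt_nbhsr.
Unshelve. all: by end_near. Qed.

Lemma phi_dyadic n : phi (2 ^- n.+1) = (n.+1%:R * ln 2) `^ (- beta).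
Proof.
rewrite phi_small; last first.
  rewrite invr_gt0 exprn_gt0//= div1r lef_pV2 ?posrE ?exprn_gt0//.
  by rewrite exprS ler_peMr// exprn_ege1// ler1n.
by rewrite lnV ?posrE ?exprn_gt0// opprK lnXn// mulr_natl.
Qed.

(** A factor [D <= 2^(N + 1)] shifts the dyadic level by at most [N + 1], which costs only a
    constant in a power of the logarithm. The finitely many levels [n <= N + 1] are absorbed by
    [c2]. *)
Lemma phi_dyadic_decay D : 0 <= D -> exists2 c, 0 < c &
  forall n, phi (D * 2 ^- n) <= c * n.+1%:R `^ (- beta).
Proof.
move=> D0; pose N := Num.truncn D.
have DN : D <= 2 ^+ N.+1.
  rewrite (le_trans (ltW (truncnS_gt _)))// -natrX ler_nat.
  exact: ltnW (ltn_expl _ _).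
(* For [n = k + N + 2] one has [n + 1 <= (N + 3) * (k + 1)], whence the divisor [N + 3]. *)
pose c1 : R := (ln 2 / N.+3%:R) `^ (- beta).
pose c2 : R := phi (2 ^+ N.+1) * N.+2%:R `^ beta.
have c10 : 0 < c1 by rewrite powR_gt0// divr_gt0.
have c20 : 0 <= c2 by rewrite mulr_ge0 ?powR_ge0 ?phi_ge0.
exists (c1 + c2); first by rewrite ltr_pwDl.
move=> n; have n0 : 0 <= n.+1%:R `^ (- beta) :> R by rewrite powR_ge0.
rewrite mulrDl; have [nN|nN] := leqP n N.+1.
  rewrite -[leLHS]add0r lerD ?mulr_ge0 ?(ltW c10)//.
  rewrite /c2 -mulrA; apply: (@le_trans _ _ (phi (2 ^+ N.+1))).
    apply: phi_le; apply: (le_trans _ DN).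
    by rewrite ler_piMr// invf_le1 ?exprn_gt0// exprn_ege1// ler1n.
  rewrite ler_peMr ?phi_ge0//.
  rewrite powRN ler_pdivlMr ?powR_gt0// mul1r.
  by rewrite ge0_ler_powR ?nnegrE ?ler_nat// ltW.
rewrite -[leLHS]addr0 lerD ?mulr_ge0 ?phi_ge0 ?powR_ge0//.
have [k nE] : exists k, n = (k + N.+2)%N by exists (n - N.+2)%N; rewrite subnK.
apply: (@le_trans _ _ (phi (2 ^- k.+1))).
  apply: phi_le; rewrite nE -addSnnS exprD invfM mulrCA ler_piMr//.
  by rewrite ler_pdivrMr ?exprn_gt0// mul1r.
rewrite phi_dyadic /c1 -powRM ?divr_ge0 ?(ltW ln2_gt0)//.
apply: ler_powRN; [exact: ltW|by rewrite mulr_gt0// divr_gt0|].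
rewrite mulrAC ler_pdivrMr// -[leRHS]mulrA [leRHS]mulrCA ler_pM2l//.
rewrite -natrM ler_nat nE; nia.
Qed.

End Modulus.

(** * Dyadic grids *)

Section Grid.
Context {R : realType} {d : nat}.
Implicit Types (x y z : 'rV[R]_d) (n m : nat) (r : R).

(** Capping the index at [2 ^ n] keeps the point in the cube for every index function, in particular
    for neighbours of boundary points. *)
Definition dyadic n (u : 'I_d -> nat) : 'rV[R]_d :=
  \row_i ((minn (u i) (2 ^ n))%:R / 2 ^+ n).

Definition dyfloor n x : 'rV[R]_d :=
  dyadic n (fun i => Num.truncn (2 ^+ n * x ord0 i)).

(* As [e] runs over [{0, 1, 2}^d], [neighbour u e] runs over the grid points
   at sup-distance at most 1 of [u], up to the truncation in [dyadic]. *)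
Definition neighbour n (u : {ffun 'I_d -> 'I_(2 ^ n).+1})
    (e : {ffun 'I_d -> 'I_3}) : 'I_d -> nat :=
  fun i => (u i + e i).-1.

Let pow2_gt0 n : 0 < 2 ^+ n :> R. Proof. by rewrite exprn_gt0. Qed.

Lemma dyadic_cube n u : unit_cube (dyadic n u).
Proof.
move=> i; rewrite mxE divr_ge0 ?exprn_ge0//=.
by rewrite ler_pdivrMr// mul1r -natrX ler_nat geq_minr.
Qed.

Lemma dyfloor_cube n x : unit_cube (dyfloor n x).
Proof. exact: dyadic_cube. Qed.

Lemma truncn_cube n x i : unit_cube x ->
  (Num.truncn (2 ^+ n * x ord0 i) <= 2 ^ n)%N.
Proof.
move=> /(_ i)/andP[x0 x1].
rewrite -(ler_nat R) natrX (@le_trans _ _ (2 ^+ n * x ord0 i))//.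
  by rewrite truncn_le mulr_ge0// ltW.
by rewrite ler_piMr// ltW.
Qed.

Lemma dyfloor_dist n x i : unit_cube x ->
  `|dyfloor n x ord0 i - x ord0 i| <= 2 ^- n.
Proof.
move=> cx; rewrite mxE (minn_idPl (truncn_cube _ _ _ cx)).
have /andP[x0 x1] := cx i.
have z0 : 0 <= 2 ^+ n * x ord0 i by rewrite mulr_ge0// ltW.
have /andP[h1 h2] := truncn_itv z0.
rewrite -(ler_pM2l (pow2_gt0 n)) mulfV ?gt_eqF//.
rewrite -[X in X * `|_|](gtr0_norm (pow2_gt0 n)) -normrM mulrBr.
rewrite mulrC divfK ?gt_eqF// distrC ger0_norm ?subr_ge0//.
by rewrite lerBlDl natr1 ltW.
Qed.

(** Grid approximations of a dyadic point are eventually constant, so passing to the limit does not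
    change values on the grids. *)
Lemma dyfloor_dyadic n m u : (n <= m)%N -> dyfloor m (dyadic n u) = dyadic n u.
Proof.
move=> nm; apply/rowP => i; rewrite !mxE -(subnK nm).
set k := minn (u i) (2 ^ n).
have -> : 2 ^+ (m - n + n) * (k%:R / 2 ^+ n) = (k * 2 ^ (m - n))%:R :> R.
  by rewrite natrM natrX exprD mulrC -mulrA (mulrC (2 ^+ n)^-1) mulfK ?gt_eqF.
rewrite natrK (minn_idPl _); last first.
  by rewrite expnD mulnC leq_mul2l geq_minr orbT.
by rewrite natrM natrX exprD invfM mulrA mulfK ?gt_eqF.
Qed.

Lemma grid_pair n (a b : 'I_d -> nat) :
  (forall i, (a i <= 2 ^ n)%N) -> (forall i, (b i <= 2 ^ n)%N) ->
  (forall i, (a i <= (b i).+1)%N && (b i <= (a i).+1)%N) ->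
  exists (u : {ffun 'I_d -> 'I_(2 ^ n).+1}) (e : {ffun 'I_d -> 'I_3}),
    dyadic n a = dyadic n (fun i => u i) /\
    dyadic n b = dyadic n (neighbour n u e).
Proof.
move=> ha hb hab.
(* The difference [b i - a i] lies in [{-1, 0, 1}]; it is stored shifted by 1, and the predecessor
   in [neighbour] undoes the shift. *)
exists [ffun i => inord (a i)], [ffun i => inord ((b i).+1 - a i)].
split; apply/rowP => i; rewrite !mxE /neighbour ?ffunE inordK ?ltnS//.
rewrite inordK; have /andP[h1 h2] := hab i; last lia.
by rewrite subnKC.
Qed.

(** After scaling by [2 ^ n] the coordinates differ by at most 1, hence so do their integer
    parts. *)
Lemma dyfloor_near n x y : unit_cube x -> unit_cube y ->
  (forall i, `|x ord0 i - y ord0 i| <= 2 ^- n) ->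
  exists (u : {ffun 'I_d -> 'I_(2 ^ n).+1}) (e : {ffun 'I_d -> 'I_3}),
    dyfloor n x = dyadic n (fun i => u i) /\
    dyfloor n y = dyadic n (neighbour n u e).
Proof.
move=> cx cy xy; apply: grid_pair => i; [exact: truncn_cube..|].
have step (a b : R) : 0 <= a -> 0 <= b -> `|a - b| <= 1 ->
    (Num.truncn a <= (Num.truncn b).+1)%N.
  move=> a0 b0 ab; rewrite truncn_le_nat -natr1.
  have := truncnS_gt b; move: ab; rewrite ler_norml => /andP[_ ab]; lra.
have z0 z : unit_cube z -> 0 <= 2 ^+ n * z ord0 i.
  by move=> /(_ i)/andP[z0 _]; rewrite mulr_ge0// ltW.
have zz (z z' : R) : `|z - z'| <= 2 ^- n -> `|2 ^+ n * z - 2 ^+ n * z'| <= 1.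
  move=> h; rewrite -mulrBr normrM (gtr0_norm (pow2_gt0 n)).
  by rewrite -ler_pdivlMl// mulr1.
by rewrite !step ?z0 ?zz// distrC.
Qed.

(** Doubling the indices turns the level [n] point into a level [n.+1] point, and the integer part
    of [2 * z] is twice that of [z] or one more. *)
Lemma dyfloor_succ n x : unit_cube x ->
  exists (u : {ffun 'I_d -> 'I_(2 ^ n.+1).+1}) (e : {ffun 'I_d -> 'I_3}),
    dyfloor n x = dyadic n.+1 (fun i => u i) /\
    dyfloor n.+1 x = dyadic n.+1 (neighbour n.+1 u e).
Proof.
move=> cx.
have -> : dyfloor n x = dyadic n.+1 (fun i => 2 * Num.truncn (2 ^+ n * x ord0 i))%N.
  apply/rowP => i; rewrite !mxE expnS -minnMr natrM exprS -mulf_div.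
  by rewrite mulfV ?mul1r// pnatr_eq0.
apply: grid_pair => i.
- by rewrite expnS leq_mul2l truncn_cube.
- exact: truncn_cube.
- have /andP[x0 _] := cx i.
  have z0 : 0 <= 2 ^+ n * x ord0 i by rewrite mulr_ge0// ltW.
  rewrite exprS -mulrA; set z := _ * x _ _ in z0 *.
  have /andP[h1 h2] := truncn_itv z0.
  have h3 : (2 * Num.truncn z)%:R <= 2 * z by rewrite natrM ler_pM2l.
  rewrite -truncn_ge_nat ?mulr_ge0// in h3; rewrite (leq_trans h3)//=.
  by rewrite truncn_le_nat -!natr1 natrM; rewrite -natr1 in h2; lra.
Qed.

Lemma enorm_le z r : 0 <= r -> (forall i, `|z ord0 i| <= r) ->
  enorm z <= Num.sqrt d%:R * r.
Proof.
move=> r0 zr; rewrite /enorm -[X in _ * X](ger0_norm r0) -sqrtr_sqr -sqrtrM ?ler0n//.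
rewrite ler_wsqrtr// -[d in d%:R]card_ord mulr_natl -sumr_const ler_sum// => i _.
by rewrite -[leLHS]real_normK ?num_real// ler_sqr ?nnegrE.
Qed.

Lemma le_enorm z i : `|z ord0 i| <= enorm z.
Proof.
rewrite -sqrtr_sqr ler_wsqrtr// (bigD1 i)//= lerDl sumr_ge0// => j _.
exact: sqr_ge0.
Qed.

Lemma enorm_gt0 z : z != 0 -> 0 < enorm z.
Proof.
move=> z0; have [i zi] : exists i, z ord0 i != 0.
  apply/existsP; apply: contra_neqT z0 => /existsPn h; apply/rowP => i.
  by rewrite mxE; apply/eqP; rewrite -[_ == _]negbK h.
by apply: lt_le_trans (le_enorm z i); rewrite normr_gt0.
Qed.

Lemma enorm_neighbour n (u : {ffun 'I_d -> 'I_(2 ^ n).+1}) (e : {ffun 'I_d -> 'I_3}) :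
  enorm (dyadic n (fun i => u i) - dyadic n (neighbour n u e)) <=
  Num.sqrt d%:R * 2 ^- n.
Proof.
apply: enorm_le => [|i]; first by rewrite invr_ge0 ltW.
rewrite !mxE -mulrBl normrM (gtr0_norm (x := _^-1)) ?invr_gt0//.
rewrite ler_piMl ?invr_ge0 ?(ltW (pow2_gt0 n))//.
have hu : (u i <= 2 ^ n)%N by rewrite -ltnS ltn_ord.
have he : (e i <= 2)%N by rewrite -ltnS ltn_ord.
set a := minn _ _; set b := minn _ _.
have ab : (a <= b.+1)%N by rewrite /a /b /neighbour; lia.
have ba : (b <= a.+1)%N by rewrite /a /b /neighbour; lia.
rewrite ler_norml; move: ab ba; rewrite -!(ler_nat R) -!natr1 => ab ba.
by apply/andP; split; lra.
Qed.

Lemma enorm_dyfloor n x : unit_cube x ->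
  enorm (dyfloor n x - x) <= Num.sqrt d%:R * 2 ^- n.
Proof.
move=> cx; apply: enorm_le => [|i]; first by rewrite invr_ge0 ltW.
by have := dyfloor_dist n x i cx; rewrite !mxE.
Qed.

Lemma cvg_pow2 : 2 ^- n @[n --> \oo] --> (0 : R).
Proof.
under eq_fun do rewrite -exprVn.
apply: cvg_expr; rewrite ger0_norm ?invr_ge0// invf_lt1//.
by rewrite ltr1n.
Qed.

(** [m.+1] is the first level whose mesh is exceeded by some coordinate of [x - y]. It is not level
    0, since coordinates in the cube differ by at most 1. *)
Lemma dyadic_scale x y : unit_cube x -> unit_cube y -> x != y ->
  exists2 m, (forall i, `|x ord0 i - y ord0 i| <= 2 ^- m) &
    2 ^- m.+1 <= enorm (x - y).
Proof.
move=> cx cy xy.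
pose far k := ~~ [forall i, `|x ord0 i - y ord0 i| <= 2 ^- k].
have ex : exists k, far k.
  have [i xi] : exists i, x ord0 i - y ord0 i != 0.
    apply/existsP; apply: contra_neqT xy => /existsPn h; apply/rowP => i.
    by apply/eqP; rewrite -subr_eq0 -[_ == _]negbK h.
  have xi0 : 0 < `|x ord0 i - y ord0 i| by rewrite normr_gt0.
  have [k _ /(_ k (leqnn k)) hk] := cvgr_lt _ cvg_pow2 _ xi0.
  by exists k; apply/forallPn; exists i; rewrite -ltNge.
case: (ex_minnP ex) => [[|m]] hm min.
  move: hm => /forallPn[i]; rewrite expr0 invr1.
  have /andP[a b] := cx i; have /andP[a' b'] := cy i.
  by rewrite ler_norml; case/negP; apply/andP; split; lra.
exists m.
  move=> i; apply/(@forallP _ (fun i => `|x ord0 i - y ord0 i| <= 2 ^- m)).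
  by apply/negPn/negP => /min; rewrite ltnn.
move: hm => /forallPn[i]; rewrite -ltNge => /ltW /le_trans; apply.
by have := le_enorm (x - y) i; rewrite !mxE.
Qed.

Lemma cvg_enorm (u : nat -> 'rV[R]_d) z :
  (forall i, u n ord0 i @[n --> \oo] --> z ord0 i) ->
  enorm (u n) @[n --> \oo] --> enorm z.
Proof.
move=> uz; apply: (@continuous_cvg _ _ _ _ _ _ Num.sqrt).
  exact: sqrt_continuous.
apply: cvg_big => // [|i _]; first exact: add_continuous.
 under eq_fun do rewrite expr2.
by rewrite expr2; apply: cvgM.
Qed.

Lemma cvg_dyfloor x i : unit_cube x ->
  dyfloor n x ord0 i @[n --> \oo] --> x ord0 i.
Proof.
move=> cx; apply/cvgrPdist_le => e e0.
near=> n; rewrite distrC; apply: le_trans (dyfloor_dist n x i cx) _.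
by near: n; exact: (cvgr_le _ cvg_pow2 _ e0).
Unshelve. all: by end_near. Qed.

End Grid.

(** * Chaining for a single path *)

(** When the increments of [U] along the grids satisfy the summability condition below, this is the
    continuous extension of [U] from the dyadic points to the cube. *)
Definition grid_limit {R : realType} {H : completeNormedModType R} {d : nat}
    (U : 'rV[R]_d -> H) (x : 'rV[R]_d) : H :=
  limn (fun n => U (dyfloor n x)).

Section Chaining.
Context {R : realType} {H : completeNormedModType R} {d : nat}.
Context {U : 'rV[R]_d -> H} {k : nat -> R} {a L : R}.
Hypotheses (a_gt0 : 0 < a) (k_ge0 : forall n, 0 <= k n)
  (U_step : forall n (u : {ffun 'I_d -> 'I_(2 ^ n).+1}) (e : {ffun 'I_d -> 'I_3}),
    `|U (dyadic n (fun i => u i)) - U (dyadic n (neighbour n u e))| <= k n)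
  (k_sum : forall N, \sum_(n < N) n.+1%:R `^ a * k n <= L).
Implicit Types (x y : 'rV[R]_d) (n m : nat).

Let tail n := L * n.+1%:R `^ (- a).

(** For [j >= n] the weight [(j + 1)^a] is at least [(n + 1)^a], which can be pulled out of the
    weighted sum. *)
Let sum_tail n m : \sum_(n <= j < m) k j <= tail n.
Proof.
have p0 j : 0 < j.+1%:R `^ a :> R by rewrite powR_gt0.
rewrite /tail powRN ler_pdivlMr//; apply: le_trans (k_sum m).
rewrite mulr_suml -(big_mkord xpredT (fun j => j.+1%:R `^ a * k j)).
have [nm|/ltnW mn] := leqP n m; last first.
  by rewrite [leLHS]big_geq// sumr_ge0// => j _; rewrite mulr_ge0// powR_ge0.
rewrite [leRHS](big_cat_nat _ (n := n))//= -[leLHS]add0r lerD//.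
  by rewrite sumr_ge0// => j _; rewrite mulr_ge0// powR_ge0.
rewrite !big_nat; apply: ler_sum => j /andP[nj _]; rewrite mulrC ler_wpM2r//.
by rewrite ge0_ler_powR ?nnegrE ?ler_nat// ltW.
Qed.

Let chain x n m : unit_cube x -> (n <= m)%N ->
  `|U (dyfloor n x) - U (dyfloor m x)| <= \sum_(n.+1 <= j < m.+1) k j.
Proof.
move=> cx /subnK <-; elim: (m - n)%N => [|i IH].
  by rewrite add0n subrr normr0 big_geq.
rewrite big_nat_recr/=; last lia.
have [u [e [eu ee]]] := dyfloor_succ (i + n) x cx.
apply: le_trans (ler_distD (U (dyfloor (i + n) x)) _ _) _; rewrite lerD//.
by rewrite addSn eu ee.
Qed.

Lemma chain_le x n m : unit_cube x -> (n <= m)%N ->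
  `|U (dyfloor n x) - U (dyfloor m x)| <= L * n.+1%:R `^ (- a).
Proof.
move=> cx nm; apply: (le_trans (chain x n m cx nm)).
apply: le_trans (sum_tail n m.+1); rewrite [leRHS]big_ltn ?lerDr//.
Qed.

Lemma cvg_tail : L * n.+1%:R `^ (- a) @[n --> \oo] --> 0.
Proof.
rewrite -(mulr0 L); apply: cvgMr.
apply/cvgrPdist_le => e e0.
near=> n; rewrite sub0r normrN ger0_norm ?powR_ge0// powRN.
rewrite -[leRHS]invrK lef_pV2 ?posrE ?invr_gt0 ?powR_gt0//.
have -> : e^-1 = (e^-1 `^ a^-1) `^ a.
  by rewrite -powRrM mulVf ?gt_eqF// powRr1// invr_ge0 ltW.
rewrite ge0_ler_powR ?nnegrE ?powR_ge0 ?(ltW a_gt0)//.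
apply: (le_trans (ltW (truncnS_gt _))); rewrite ler_nat ltnS.
near: n; exact: nbhs_infty_ge.
Unshelve. all: by end_near. Qed.

(** By [chain_le] the grid values form a Cauchy sequence, and [H] is complete. *)
Lemma cvg_chain x : unit_cube x -> cvgn (fun n => U (dyfloor n x)).
Proof.
move=> cx; apply/cauchy_cvgP/cauchy_exP => e e0.
have [n _ hn] := cvgr_lt _ cvg_tail _ e0.
exists (U (dyfloor n x)); exists n => // m /= nm.
rewrite -ball_normE/=; apply: le_lt_trans (hn n (leqnn n)).
exact: chain_le.
Qed.

Local Notation V := (grid_limit U).

Lemma chain_lim_le x n : unit_cube x ->
  `|U (dyfloor n x) - V x| <= L * n.+1%:R `^ (- a).
Proof.
move=> cx; have h : `|U (dyfloor n x) - U (dyfloor m x)| @[m --> \oo] -->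
    `|U (dyfloor n x) - V x|.
  by apply: cvg_norm; apply: cvgB; [exact: cvg_cst|exact: cvg_chain].
rewrite -(cvg_lim _ h)//; apply: limr_le; first exact: cvgP h.
near=> m; apply: chain_le => //; near: m; exact: nbhs_infty_ge.
Unshelve. all: by end_near. Qed.

Lemma chain_lim_dyadic n u : V (dyadic n u) = U (dyadic n u).
Proof.
apply: cvg_lim => //; apply: (cvg_near_cst (U (dyadic n u))).
near=> m; rewrite dyfloor_dyadic//; near: m; exact: nbhs_infty_ge.
Unshelve. all: by end_near. Qed.

(** The constant 3 counts the passage from [x] to its level [m] grid point, one step between
    neighbouring grid points, and the passage back to [y]. *)
Lemma chain_modulus x y m : unit_cube x -> unit_cube y ->
  (forall i, `|x ord0 i - y ord0 i| <= 2 ^- m) ->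
  `|V x - V y| <= 3 * (L * m.+1%:R `^ (- a)).
Proof.
move=> cx cy xy.
have [u [e [eu ee]]] := dyfloor_near m x y cx cy xy.
have h : `|U (dyfloor m x) - U (dyfloor m y)| <= L * m.+1%:R `^ (- a).
  rewrite eu ee (le_trans (U_step _ _ _))//.
  by have := sum_tail m m.+1; rewrite big_nat1.
have := ler_distD (U (dyfloor m x)) (V x) (V y).
have := ler_distD (U (dyfloor m y)) (U (dyfloor m x)) (V y).
have := chain_lim_le x m cx; have := chain_lim_le y m cy.
rewrite (distrC (V x) (U _)); lra.
Qed.

Lemma chain_continuous : {within unit_cube, continuous V}.
Proof.
apply/subspace_continuousP => x cx; apply/cvgrPdist_le => e e0.
have e3 : 0 < e / 3 by rewrite divr_gt0.
have [m _ hm] := cvgr_lt _ cvg_tail _ e3.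
have {}hm := hm m (leqnn m).
(* Balls of row vectors are coordinatewise, so radius [2 ^- m] gives exactly the hypothesis of
   [chain_modulus]. *)
rewrite near_withinE; apply/nbhs_ballP; exists (2 ^- m).
  by rewrite /= invr_gt0 exprn_gt0.
move=> y [_ xy] cy; apply: (@le_trans _ _ (3 * (L * m.+1%:R `^ (- a)))); last lra.
by apply: chain_modulus => // i; exact/ltW/xy.
Qed.

End Chaining.

(** * The random field *)

Section OpenLimits.
Context {R : realType} {disp : measure_display} {Omega : measurableType disp}
  {H : completeNormedModType R}.
Local Notation borelH := (g_sigma_algebraType (@open H)).

(* [H] need not be separable, so the limit is handled through the closed sets
   [{z | ball z (1/k) `<=` O}] exhausting an open set [O]. *)
Lemma measurable_limn_open (D : set Omega) (u : nat -> Omega -> H) (O : set H) :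
  measurable D -> (forall n, measurable_fun setT (u n : Omega -> borelH)) ->
  (forall w, D w -> cvgn (u ^~ w)) -> open O ->
  measurable (D `&` [set w | O (limn (u ^~ w))]).
Proof.
move=> mD mu cu oO.
pose far (k : nat) : set H := \bigcup_(z in ~` O) ball z k.+1%:R^-1.
have ofar k : open (far k) by apply: bigcup_open => z _; exact: ball_open.
have mfar k n : measurable [set w | ~ far k (u n w)].
  have := mu n measurableT (~` (far k : set borelH)).
  rewrite setTI; apply.
  by apply: measurableC; apply: sub_sigma_algebra; exact: ofar.
(* The limit lies in [O] exactly when, for some [k], the terms eventually stay out of [far k]; this
   is a countable combination of measurable events. *)
have -> : D `&` [set w | O (limn (u ^~ w))] = D `&`
    \bigcup_k \bigcup_n \bigcap_(m in [set m | (n <= m)%N]) [set w | ~ far k (u m w)].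
  apply/seteqP; split => w [Dw] /=.
    move=> Ol; split => //; set l := limn _ in Ol.
    have /nbhs_ballP[e /= e0 he] := open_nbhs_nbhs (conj oO Ol).
    have [k hk] : exists k, k.+1%:R^-1 < e / 2.
      exists (Num.truncn (e / 2)^-1); rewrite -[ltRHS]invrK.
      by rewrite ltf_pV2 ?posrE ?invr_gt0 ?divr_gt0// truncnS_gt.
    have e2 : 0 < e / 2 by rewrite divr_gt0.
    have /cvgrPdist_lt/(_ _ e2)[n _ hn] := cu w Dw.
    exists k => //; exists n => // m /= nm [z Oz] zu; apply: Oz; apply: he.
    rewrite -ball_normE /= in zu *; have := hn m nm; rewrite -/l => lu.
    apply: le_lt_trans (ler_distD (u m w) l z) _; rewrite (distrC (u m w) z).
    by rewrite (splitr e) ltrD// (lt_trans zu).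
  move=> [k _ [n _ hn]]; split => //; set l := limn _.
  apply: contrapT => Ol.
  have k0 : 0 < k.+1%:R^-1 :> R by rewrite invr_gt0.
  have /cvgrPdist_lt/(_ _ k0)[n' _ hn'] := cu w Dw.
  apply: (hn (maxn n n')); first exact: leq_maxl.
  by exists l => //; rewrite -ball_normE; apply: hn'; exact: leq_maxr.
apply: measurableI => //; apply: bigcupT_measurable => k.
apply: bigcupT_measurable => n; apply: bigcap_measurable; first by exists n => /=.
by move=> m _; exact: mfar.
Qed.

End OpenLimits.

Section RandomField.
Context {R : realType} {disp : measure_display} {Omega : measurableType disp}.
Context {P : probability Omega R} {H : completeNormedModType R} {d : nat}.
Context {X : R -> 'rV[R]_d -> Omega -> H} {gamma beta C theta : R} {f : R -> R}.
Context {e K : R}.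
Hypotheses (d_gt0 : (0 < d)%N) (X_field : stochastic_field X)
  (gamma_gt0 : 0 < gamma) (beta_gt0 : 0 < beta) (C_gt0 : 0 < C)
  (K_gt0 : 0 < K) (alpha_gt0 : 0 < 1 / gamma - theta)
  (f_mono : {in `[1 / 2, +oo[ &, {homo f : r s / r <= s}})
  (f_cont : {within `[1 / 2, +oo[, continuous f})
  (f_half : f (1 / 2) = ln 2 `^ (- beta))
  (e_lt : e - beta < - 1)
  (hoelder_weight : forall (k : nat -> R) B, (forall n, 0 <= k n) -> 0 < B ->
    (forall N, \sum_(n < N) n.+1%:R `^ e * k n `^ gamma <= B) ->
    forall N, \sum_(n < N) n.+1%:R `^ ((1 / gamma - theta) * beta) * k n
      <= K * B `^ gamma^-1).

Let dist x y w := sup_time (fun t w => (`|X t x w - X t y w| `^ gamma)%:E) w.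

Hypotheses (dist_meas : forall x y, unit_cube x -> unit_cube y ->
    measurable_fun [set: Omega] (dist x y))
  (dist_moment : forall x y, unit_cube x -> unit_cube y ->
    (\int[P]_w dist x y w <=
      (C * enorm (x - y) ^+ d * phi beta f (enorm (x - y)))%:E)%E).

Let dist_ub t x y w : t \in `[0, 1] ->
  ((`|X t x w - X t y w| `^ gamma)%:E <= dist x y w)%E.
Proof. by move=> t01; apply: ereal_sup_ubound; exists t. Qed.

Let dist_ge0 x y w : (0 <= dist x y w)%E.
Proof.
apply: le_trans (dist_ub 0 x y w _); first by rewrite lee_fin powR_ge0.
by rewrite in_itv/= lexx ler01.
Qed.

(** Since [phi] is nondecreasing, both factors of the moment bound may be taken at [sqrt d * 2^-n],
    where [phi_dyadic_decay] applies with [D = sqrt d]. *)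
Let int_dist : exists2 c, 0 < c & forall n x y, unit_cube x -> unit_cube y ->
  enorm (x - y) <= Num.sqrt d%:R * 2 ^- n ->
  (\int[P]_w dist x y w <= (c * (2 ^- n) ^+ d * n.+1%:R `^ (- beta))%:E)%E.
Proof.
have [c c0 hc] := phi_dyadic_decay beta_gt0 f_mono f_half (Num.sqrt d%:R) (sqrtr_ge0 _).
exists (C * Num.sqrt d%:R ^+ d * c).
  by rewrite !mulr_gt0// exprn_gt0// sqrtr_gt0 ltr0n.
move=> n x y cx cy xy; apply: le_trans (dist_moment x y cx cy) _.
rewrite lee_fin -!mulrA ler_pM2l//.
rewrite [leRHS](_ : _ = (Num.sqrt d%:R * 2 ^- n) ^+ d * (c * n.+1%:R `^ (- beta)));
  last by rewrite exprMn; ring.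
have e0 : 0 <= enorm (x - y) by exact: sqrtr_ge0.
apply: ler_pM; rewrite ?exprn_ge0//.
- exact: phi_ge0.
- by apply: lerXn2r; rewrite ?nnegrE// mulr_ge0 ?sqrtr_ge0 ?invr_ge0 ?exprn_ge0.
- by apply: le_trans (hc n); apply: phi_le.
Qed.

(** * Integrability of the weighted neighbour sums *)

Let G n w := (\sum_(p : {ffun 'I_d -> 'I_(2 ^ n).+1} * {ffun 'I_d -> 'I_3})
  dist (dyadic n (fun i => p.1 i)) (dyadic n (neighbour n p.1 p.2)) w)%E.

Let G_ge0 n w : (0 <= G n w)%E.
Proof. by apply: sume_ge0 => p _; exact: dist_ge0. Qed.

Let measurable_G n : measurable_fun setT (G n).
Proof. by apply: emeasurable_sum => p; apply: dist_meas; exact: dyadic_cube. Qed.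

(** There are [(2^n + 1)^d * 3^d] summands; multiplied by [(2^-n)^d] this is at most [6^d]. *)
Let int_G : exists2 c, 0 < c &
  forall n, (\int[P]_w G n w <= (c * n.+1%:R `^ (- beta))%:E)%E.
Proof.
have [c c0 hc] := int_dist.
exists (c * 6 ^+ d); first by rewrite mulr_gt0// exprn_gt0.
move=> n; rewrite ge0_integral_sum//; last first.
  by move=> p; apply: dist_meas; exact: dyadic_cube.
apply: (@le_trans _ _ (\sum_(p : {ffun 'I_d -> 'I_(2 ^ n).+1} * {ffun 'I_d -> 'I_3})
    (c * (2 ^- n) ^+ d * n.+1%:R `^ (- beta))%:E)%E).
  by apply: lee_sum => p _; apply: hc; [exact: dyadic_cube..|exact: enorm_neighbour].
rewrite sumEFin sumr_const lee_fin card_prod !card_ffun !card_ord.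
rewrite -[leLHS]mulr_natl natrM !natrX -!mulrA.
rewrite (_ : (2 ^ n).+1%:R ^+ d * _ =
    c * (((2 ^ n).+1%:R * 2 ^- n * 3) ^+ d * n.+1%:R `^ (- beta)));
  last by rewrite !exprMn; ring.
rewrite ler_pM2l// ler_wpM2r ?powR_ge0// lerXn2r ?nnegrE//.
have : (2 ^ n).+1%:R * 2 ^- n <= 2 :> R.
  rewrite ler_pdivrMr ?exprn_gt0// -natr1 natrX.
  have : 1 <= 2 ^+ n :> R by rewrite exprn_ege1// ler1n.
  lra.
lra.
Qed.

Let A w := (\sum_(n <oo) ((n.+1%:R `^ e)%:E * G n w))%E.

Let A_term_ge0 n w : (0 <= (n.+1%:R `^ e)%:E * G n w)%E.
Proof. by rewrite mule_ge0// lee_fin powR_ge0. Qed.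

Let A_ge0 w : (0 <= A w)%E. Proof. exact: nneseries_ge0. Qed.

Let measurable_A : measurable_fun setT A.
Proof.
by apply: ge0_emeasurable_sum => // n _; exact: measurable_funeM.
Qed.

Let int_A : (\int[P]_w A w < +oo)%E.
Proof.
have [c c0 hc] := int_G.
rewrite integral_nneseries//; last by move=> n; exact: measurable_funeM.
(* The surplus in [e - beta < -1]: weight and decay multiply to [(n + 1)^(- (1 + del))]. *)
pose del := beta - e - 1.
have del0 : 0 < del by rewrite /del subr_gt0 -ltrN2 opprB.
apply: (@le_lt_trans _ _ (c * (1 + del^-1))%:E); last by rewrite ltry.
apply: lime_le.
  by apply: is_cvg_nneseries => n _ _; apply: integral_ge0 => w _.
apply: nearW => N; rewrite big_mkord.
apply: (@le_trans _ _ (\sum_(n < N) (c * n.+1%:R `^ (- (1 + del)))%:E)%E).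
  apply: lee_sum => n _; rewrite ge0_integralZl ?lee_fin ?powR_ge0//.
  apply: le_trans (lee_wpmul2l _ (hc n)) _; first by rewrite lee_fin powR_ge0.
  rewrite -EFinM lee_fin mulrCA ler_pM2l// -powRD ?pnatr_eq0 ?implybT//.
  by rewrite le_eqVlt; apply/orP; left; apply/eqP; congr (_ `^ _); rewrite /del; ring.
rewrite sumEFin lee_fin -mulr_sumr ler_pM2l//; exact: sum_powR_le.
Qed.

Let good := [set w | (A w < +oo)%E].

Let measurable_good : measurable good.
Proof.
by have := emeasurable_fun_infty_o measurableT measurable_A +oo%E; rewrite setTI.
Qed.

Let ae_good : {ae P, forall w, good w}.
Proof.
have : {ae P, forall w, setT w -> A w \is a fin_num}.
  apply: integrable_ae => //; apply/integrableP; split => //.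
  by under eq_integral do rewrite gee0_abs//.
by apply: filterS => w /(_ I); rewrite ge0_fin_numE.
Qed.

(** * Path estimates on the event [good] *)

Let a := (1 / gamma - theta) * beta.
Let k n w := fine (G n w) `^ gamma^-1.
(** The [+ 1] supplies the positive bound that [hoelder_weight] asks for, even when [A w = 0].
    Independence of [t] makes all later path estimates uniform in time. *)
Let L w := K * (fine (A w) + 1) `^ gamma^-1.

Let a_gt0 : 0 < a. Proof. exact: mulr_gt0. Qed.

Let gi_gt0 : 0 < gamma^-1. Proof. by rewrite invr_gt0. Qed.

Let powRVK (r : R) : 0 <= r -> (r `^ gamma) `^ gamma^-1 = r.
Proof. by move=> r0; rewrite -powRrM mulfV ?gt_eqF// powRr1. Qed.

Let powRKV (r : R) : 0 <= r -> (r `^ gamma^-1) `^ gamma = r.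
Proof. by move=> r0; rewrite -powRrM mulVf ?gt_eqF// powRr1. Qed.

Let k_ge0 n w : 0 <= k n w. Proof. exact: powR_ge0. Qed.

Let sum_A N w : (\sum_(n < N) (n.+1%:R `^ e)%:E * G n w <= A w)%E.
Proof.
rewrite -(big_mkord xpredT (fun n => ((n.+1%:R `^ e)%:E * G n w)%E)).
exact: nneseries_lim_ge.
Qed.

Let A_fin w : good w -> A w = (fine (A w))%:E.
Proof. by move=> gw; rewrite fineK// ge0_fin_numE. Qed.

(** The weights are positive, so an infinite [G n w] would make a partial sum of [A w] infinite. *)
Let G_fin n w : good w -> G n w = (fine (G n w))%:E.
Proof.
move=> gw; rewrite fineK// ge0_fin_numE// ltNge leye_eq; apply/eqP => Goo.
have := sum_A n.+1 w; rewrite big_ord_recr/= Goo gt0_muley ?lte_fin ?powR_gt0//.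
rewrite addey; last by rewrite gt_eqF// (lt_le_trans ltNy0)// sume_ge0.
by rewrite leye_eq => /eqP Aoo; move: gw; rewrite /good/= Aoo ltxx.
Qed.

Let U_step w t : good w -> t \in `[0, 1] ->
  forall n (u : {ffun 'I_d -> 'I_(2 ^ n).+1}) (s : {ffun 'I_d -> 'I_3}),
  `|X t (dyadic n (fun i => u i)) w - X t (dyadic n (neighbour n u s)) w| <= k n w.
Proof.
move=> gw t01 n u s; set x := dyadic n _; set y := dyadic n _.
have : (dist x y w <= G n w)%E.
  rewrite /G (bigD1 (u, s))//= leeDl// sume_ge0// => p _; exact: dist_ge0.
move/(le_trans (dist_ub t x y w t01)); rewrite G_fin// lee_fin => h.
rewrite -[leLHS]powRVK// /k ge0_ler_powR ?nnegrE ?powR_ge0 ?(ltW gi_gt0)//.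
by rewrite fine_ge0.
Qed.

Let k_sum w : good w -> forall N, \sum_(n < N) n.+1%:R `^ a * k n w <= L w.
Proof.
move=> gw; apply: (hoelder_weight (fun n => k n w)) => [n||N]; first exact: k_ge0.
  by rewrite ltr_pwDr// fine_ge0.
apply: (@le_trans _ _ (fine (A w))); last by rewrite lerDl.
rewrite -lee_fin -A_fin//; apply: le_trans (sum_A N w).
rewrite -sumEFin; apply: lee_sum => n _.
by rewrite /k powRKV ?fine_ge0// G_fin.
Qed.

(* [P] need not be complete: freezing the field at [x = 0] off [good] keeps the
   event [Xt t x = X t x for all t] measurable there. *)
Let Xt t x w := if `[< good w >] then grid_limit (fun y => X t y w) x else X t 0 w.

Let Xt_good w t : good w -> (fun x => Xt t x w) = grid_limit (fun y => X t y w).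
Proof. by move=> gw; apply/funext => x; rewrite /Xt asboolT. Qed.

Let Xt_bad w t : ~ good w -> (fun x => Xt t x w) = (fun=> X t 0 w).
Proof. by move=> gw; apply/funext => x; rewrite /Xt asboolF. Qed.

(** * Measurability, realization property and continuity of the limit field *)

Let cube0 : unit_cube (0 : 'rV[R]_d).
Proof. by move=> i; rewrite mxE lexx ler01. Qed.

Let Xt_field : stochastic_field Xt.
Proof.
move=> t x t01 cx; apply: measurability => // _ [V oV <-]; rewrite setTI.
have -> : Xt t x @^-1` V = (good `&` [set w | V (limn (fun n => X t (dyfloor n x) w))])
    `|` (~` good `&` X t 0 @^-1` V).
  apply/seteqP; split => w /=; rewrite /Xt.
    by case: asboolP => gw Vw; [left|right].
  by case=> -[gw Vw]; [rewrite asboolT|rewrite asboolF].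
apply: measurableU.
  apply: (measurable_limn_open good (fun n => X t (dyfloor n x))) => //.
  - by move=> n; apply: X_field => //; exact: dyfloor_cube.
  - move=> w gw.
    exact: (cvg_chain (U := fun y => X t y w) a_gt0 (k_ge0^~ w) (U_step w t gw t01)
      (k_sum w gw)).
apply: measurableI; first exact: measurableC.
have := X_field t 0 t01 cube0 measurableT (V : set (g_sigma_algebraType (@open H))).
by rewrite setTI; apply; exact: sub_sigma_algebra.
Qed.

(** The agreement of [Xt] and [X] at [x] for all [t] is an uncountable intersection of events. On
    [good] it amounts to [J x w = 0], which is a measurable condition; the lower limit is the form
    suited to Fatou's lemma. *)
Let J x w := limn_einf (fun n => dist (dyfloor n x) x w).

Let measurable_J x : unit_cube x -> measurable_fun setT (J x).
Proof.
move=> cx.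
have -> : J x = (fun w => - limn_esup (fun n => - dist (dyfloor n x) x w))%E.
  apply/funext => w; rewrite /J -limn_einfN; congr limn_einf.
  by apply/funext => n /=; rewrite oppeK.
apply: measurableT_comp => //; apply: measurable_fun_limn_esup => n.
apply: measurableT_comp => //; apply: dist_meas => //; exact: dyfloor_cube.
Qed.

Let J_ge0 x w : (0 <= J x w)%E.
Proof.
rewrite /J limn_einf_lim; apply: lime_ge; first exact: is_cvg_einfs.
by apply: nearW => n; apply/ereal_infP => _ [m _ <-].
Qed.

(** By Fatou's lemma the integral of [J x] is at most the lower limit of the integrals of
    [dist (dyfloor n x) x], which tend to 0 by [int_dist]. *)
Let ae_J x : unit_cube x -> {ae P, forall w, J x w = 0%E}.
Proof.
move=> cx; have mJ := measurable_J x cx.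
have J0 : (\int[P]_w J x w = 0)%E.
  apply/eqP; rewrite eq_le integral_ge0// andbT.
  apply: le_trans (fatou P measurableT _ _) _.
  - by move=> n; apply: dist_meas => //; exact: dyfloor_cube.
  - by move=> n w _; exact: dist_ge0.
  - have [c c0 hc] := int_dist.
    have cv : (\int[P]_w dist (dyfloor n x) x w)%E @[n --> \oo] --> 0%E.
      apply: (@squeeze_cvge _ _ _ _ (fun=> 0%E) _
        (fun n => (c * n.+1%:R `^ (- beta))%:E)).
      + apply: nearW => n; apply/andP; split; first exact: integral_ge0.
        apply: le_trans (hc n _ _ (dyfloor_cube n x) cx (enorm_dyfloor n x cx)) _.
        rewrite lee_fin ler_wpM2r ?powR_ge0// ler_piMr ?(ltW c0)//.
        rewrite exprn_ile1 ?invr_ge0 ?exprn_ge0// invf_le1 ?exprn_gt0//.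
        by rewrite exprn_ege1// ler1n.
      + exact: cvg_cst.
      + by apply: cvg_EFin; [exact: nearW|exact: (cvg_tail (L := c) beta_gt0)].
    by rewrite (cvg_limn_einf_sup cv).1.
have : (\int[P]_(w in setT) `|J x w| = 0)%E.
  by under eq_integral do rewrite gee0_abs//.
by move/(ae_eq_integral_abs P measurableT mJ); apply: filterS => w /(_ I).
Qed.

(** On [good] the grid values converge to [Xt] uniformly in [t], so agreement forces
    [dist (dyfloor n x) x w] to 0. Conversely, a discrepancy [r > 0] at a single [t] keeps this
    quantity eventually above [(r / 2)^gamma]. *)
Let Xt_eq x w : unit_cube x -> good w ->
  (forall t, t \in `[0, 1] -> Xt t x w = X t x w) <-> J x w = 0%E.
Proof.
move=> cx gw; split => [XtX|J0 t t01].
  have cv : dist (dyfloor n x) x w @[n --> \oo] --> 0%E.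
    apply: (@squeeze_cvge _ _ _ _ (fun=> 0%E) _
      (fun n => (L w `^ gamma * n.+1%:R `^ (- (a * gamma)))%:E)).
    - apply: nearW => n; rewrite dist_ge0/=.
      apply: ge_ereal_sup => _ [t t01 <-]; rewrite lee_fin -mulNr powRrM.
      have h : `|X t (dyfloor n x) w - X t x w| <= L w * n.+1%:R `^ (- a).
        rewrite -XtX// (congr1 (fun g => g x) (Xt_good w t gw)).
        exact: (chain_lim_le (U := fun y => X t y w) a_gt0 (k_ge0^~ w)
          (U_step w t gw t01) (k_sum w gw)).
      rewrite -powRM ?powR_ge0//; last first.
        by rewrite /L mulr_ge0 ?powR_ge0// ltW.
      by rewrite ge0_ler_powR ?nnegrE ?(ltW gamma_gt0)// (le_trans _ h).
    - exact: cvg_cst.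
    - apply: cvg_EFin; first exact: nearW.
      exact: (cvg_tail (L := L w `^ gamma) (mulr_gt0 a_gt0 gamma_gt0)).
  by rewrite /J (cvg_limn_einf_sup cv).1.
rewrite (congr1 (fun g => g x) (Xt_good w t gw)).
have cvX := cvg_chain (U := fun y => X t y w) a_gt0 (k_ge0^~ w) (U_step w t gw t01)
  (k_sum w gw) x cx.
set l := grid_limit _ _; apply: contrapT => lX.
have r0 : 0 < `|l - X t x w| by rewrite normr_gt0 subr_eq0; apply/eqP.
set r := `|l - X t x w| in r0.
have r2 : 0 < r / 2 by rewrite divr_gt0.
have /cvgrPdist_lt/(_ _ r2)[n _ hn] := cvX; rewrite -/(grid_limit _ x) -/l in hn.
suff : (((r / 2) `^ gamma)%:E <= J x w)%E.
  by rewrite J0 leNgt lte_fin powR_gt0.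
rewrite /J limn_einf_lim; apply: lime_ge; first exact: is_cvg_einfs.
exists n => // m /= nm; apply/ereal_infP => _ [j /= mj <-].
apply: le_trans (dist_ub t _ _ w t01); rewrite lee_fin.
rewrite ge0_ler_powR ?nnegrE ?(ltW gamma_gt0) ?(ltW r2)//.
have := hn j (leq_trans nm mj).
have := ler_distD (X t (dyfloor j x) w) l (X t x w).
rewrite -/r => h1 /ltW h2; move: h1; rewrite {1}(splitr r).
by move=> /le_trans/(_ (lerD h2 (lexx _))); rewrite lerD2l.
Qed.

Let Xt_realization : realization P X Xt.
Proof.
split=> // x cx; set E := [set w | _].
(* Off [good] the field [Xt] is frozen at its value at 0, so agreement at [x] there means that
   [dist 0 x] vanishes. *)
have EE : E = (good `&` (J x @^-1` [set 0%E])) `|`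
    (~` good `&` (dist 0 x @^-1` [set 0%E])).
  apply/seteqP; split => w /=.
    move=> Ew; have [gw|gw] := pselect (good w).
      by left; split => //; apply/Xt_eq.
    right; split => //; apply/eqP; rewrite eq_le dist_ge0 andbT.
    apply: ge_ereal_sup => _ [t t01 <-]; rewrite -(Ew t t01).
    rewrite (congr1 (fun g => g x) (Xt_bad w t gw)) subrr normr0 powR0//.
    by rewrite gt_eqF.
  case=> -[gw h]; first exact/Xt_eq.
  move=> t t01; rewrite (congr1 (fun g => g x) (Xt_bad w t gw)).
  have := dist_ub t 0 x w t01; rewrite h lee_fin => h0.
  have : `|X t 0 w - X t x w| `^ gamma == 0 by rewrite eq_le h0 powR_ge0.
  by rewrite powR_eq0 normr_eq0 subr_eq0 => /andP[/eqP].
have mE : measurable E.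
  rewrite EE; apply: measurableU; apply: measurableI => //; last 2 first.
  - exact: measurableC.
  - by rewrite -[X in measurable X]setTI; apply: dist_meas.
  - by rewrite -[X in measurable X]setTI; exact: measurable_J.
split => //.
have : P (~` E) = 0%E.
  apply: measure_negligible; first exact: measurableC.
  suff : {ae P, forall w, E w} by [].
  by apply: (filterS _ (filterI ae_good (ae_J x cx))) => w [gw Jw]; rewrite EE; left.
by rewrite probability_setC// => /eqP; rewrite sube_eq// add0e => /eqP.
Qed.

Let Xt_continuous : continuous_in_space P Xt.
Proof.
apply: aeW => w t t01; have [gw|gw] := pselect (good w).
  rewrite (Xt_good w t gw).
  exact: (chain_continuous a_gt0 (k_ge0^~ w) (U_step w t gw t01) (k_sum w gw)).
by rewrite (Xt_bad w t gw); apply: continuous_subspaceT => x; exact: cst_continuous.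
Qed.

(** * Moment bound and measurability for the Hoelder seminorm *)

Section Seminorm.
Variable alpha : R.
Hypothesis alphaP : 0 < alpha <= 1 / gamma - theta.

Local Notation phi := (phi beta f).
Let S := sup_time (fun t w =>
  (holder_seminorm alpha phi (fun x => Xt t x w) `^ gamma)%E).
(** The diameter of the cube is [sqrt d], so this constant bounds the surplus power of [phi] when
    the exponent is lowered from [1 / gamma - theta] to [alpha]. *)
Let Phi := phi (Num.sqrt d%:R) `^ (1 / gamma - theta - alpha).

Let gamma_ge0 : 0 <= gamma. Proof. exact: ltW. Qed.

Let phi_pos r : 0 < r -> 0 < phi r.
Proof. exact: phi_gt0. Qed.

Let L_ge0 w : 0 <= L w.
Proof. by rewrite mulr_ge0 ?powR_ge0// ltW. Qed.

Let holder_good w t x y : good w -> t \in `[0, 1] -> unit_cube x -> unit_cube y ->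
  x != y ->
  `|Xt t x w - Xt t y w| / phi (enorm (x - y)) `^ alpha <= 3 * L w * Phi.
Proof.
move=> gw t01 cx cy xy; have r0 : 0 < enorm (x - y) by rewrite enorm_gt0// subr_eq0.
rewrite ler_pdivrMr ?powR_gt0 ?phi_pos//.
have [m hm rm] := dyadic_scale x y cx cy xy.
rewrite (congr1 (fun g => g x) (Xt_good w t gw)) (congr1 (fun g => g y) (Xt_good w t gw)).
apply: le_trans (chain_modulus (U := fun y => X t y w) a_gt0 (k_ge0^~ w)
  (U_step w t gw t01) (k_sum w gw) x y m cx cy hm) _.
have hL : 0 <= 3 * L w by rewrite mulr_ge0 ?L_ge0.
rewrite [leLHS]mulrA -[leRHS]mulrA (ler_wpM2l hL)//.
apply: (@le_trans _ _ (phi (enorm (x - y)) `^ (1 / gamma - theta))).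
  rewrite (_ : m.+1%:R `^ _ = (m.+1%:R `^ (- beta)) `^ (1 / gamma - theta));
    last by rewrite -powRrM /a mulNr mulrC.
  rewrite ge0_ler_powR ?nnegrE ?powR_ge0 ?(ltW alpha_gt0) ?(ltW (phi_pos _ r0))//.
  apply: le_trans (phi_le beta_gt0 f_mono f_half _ _ rm).
  (* Since [ln 2 <= 1], the value [phi (2^-(m + 1))] dominates [(m + 1)^(- beta)]. *)
  rewrite phi_dyadic//; apply: ler_powRN; first exact: ltW.
    by rewrite mulr_gt0// ln_gt0// ltr1n.
  rewrite ler_piMr//; have := @le_ln1Dx R 1 (lt_trans (ltrN10 _) ltr01).
  by [].
rewrite -{1}(subrK alpha (1 / gamma - theta)).
rewrite powRD ?(gt_eqF (phi_pos _ r0)) ?implybT//.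
rewrite ler_wpM2r ?powR_ge0// /Phi ge0_ler_powR ?nnegrE ?phi_ge0//.
  by rewrite subr_ge0; case/andP: alphaP.
apply: phi_le => //; rewrite -[leRHS]mulr1; apply: enorm_le => // i.
have /andP[x0 x1] := cx i; have /andP[y0 y1] := cy i.
by rewrite !mxE ler_norml; apply/andP; split; lra.
Qed.

Let cube1 : unit_cube (const_mx 1 : 'rV[R]_d).
Proof. by move=> i; rewrite mxE lexx ler01. Qed.

Let neq01 : (0 : 'rV[R]_d) != const_mx 1.
Proof.
apply/eqP => /rowP/(_ (Ordinal d_gt0)); rewrite !mxE => /esym/eqP.
by rewrite oner_eq0.
Qed.

Let holder_ub (u : 'rV[R]_d -> H) x y : unit_cube x -> unit_cube y -> x != y ->
  ((`|u x - u y| / phi (enorm (x - y)) `^ alpha)%:E <= holder_seminorm alpha phi u)%E.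
Proof. by move=> cx cy xy; apply: ereal_sup_ubound; exists x, y; split. Qed.

(** For [d > 0] the cube has two distinct points, so the supremum is not over the empty set, where
    it would be [-oo]. *)
Let holder_ge0 (u : 'rV[R]_d -> H) : (0 <= holder_seminorm alpha phi u)%E.
Proof.
apply: le_trans (holder_ub u _ _ cube0 cube1 neq01).
by rewrite lee_fin divr_ge0 ?powR_ge0.
Qed.

Let poweR_le (r : R) (x y : \bar R) : 0 <= r -> (0 <= x)%E -> (x <= y)%E ->
  (x `^ r <= y `^ r)%E.
Proof.
move=> r0 x0 xy; apply: gt0_ler_poweR => //; rewrite in_itv/= leey andbT//.
exact: le_trans xy.
Qed.

Let S_ge0 w : (0 <= S w)%E.
Proof.
apply: (@le_trans _ _ (holder_seminorm alpha phi (fun x => Xt 0 x w) `^ gamma)%E).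
  exact: poweR_ge0.
by apply: ereal_sup_ubound; exists 0 => //=; rewrite in_itv/= lexx ler01.
Qed.

Let S_bad w : ~ good w -> S w = 0%E.
Proof.
move=> gw; apply/eqP; rewrite eq_le S_ge0 andbT.
apply: ge_ereal_sup => _ [t t01 <-]; rewrite (Xt_bad w t gw).
rewrite (_ : holder_seminorm _ _ _ = 0%E) ?poweR0r ?gt_eqF//.
apply/eqP; rewrite eq_le holder_ge0 andbT.
by apply: ge_ereal_sup => _ [x [y [_ _ _ ->]]]; rewrite subrr normr0 mul0r.
Qed.

(** The [gamma]-th power of [holder_good] turns [L w] into [K^gamma * (A w + 1)]; off [good] the
    field is constant in space and [S] vanishes. *)
Let S_bound : exists2 c, 0 <= c & forall w, (S w <= c%:E * (A w + 1))%E.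
Proof.
exists ((3 * K * Phi) `^ gamma) => [|w]; first exact: powR_ge0.
have [gw|gw] := pselect (good w); last first.
  by rewrite S_bad// mule_ge0 ?lee_fin ?powR_ge0// adde_ge0.
apply: ge_ereal_sup => _ [t t01 <-].
have h0 : 0 <= 3 * L w * Phi by rewrite mulr_ge0 ?powR_ge0// mulr_ge0// L_ge0.
apply: (@le_trans _ _ ((3 * L w * Phi)%:E `^ gamma)%E).
  apply: poweR_le => //; apply: ge_ereal_sup => _ [x [y [cx cy xy ->]]].
  by rewrite lee_fin holder_good.
rewrite A_fin// -EFinD poweR_EFin -EFinM lee_fin /L.
rewrite (_ : 3 * _ * Phi = (3 * K * Phi) * (fine (A w) + 1) `^ gamma^-1);
  last by ring.
have K0 : 0 <= 3 * K * Phi by rewrite mulr_ge0 ?powR_ge0// mulr_ge0// ltW.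
by rewrite powRM ?powR_ge0// powRKV// addr_ge0// fine_ge0.
Qed.

(* [Q] is the supremum of the Hoelder quotients over the countably many pairs
   of dyadic points; it is measurable and agrees with [S] on [good]. *)
Let idx : countType := ((nat * {ffun 'I_d -> nat}) * (nat * {ffun 'I_d -> nat}))%type.

(** The value 0 at coinciding points and at [None] keeps [Q] nonnegative and, as [S] is nonnegative,
    does not spoil the bound by [S]. *)
Let quot (j : option idx) w : \bar R :=
  if j is Some ((n, u), (m, v)) then
    if dyadic n u == dyadic m v :> 'rV[R]_d then 0%E
    else (dist (dyadic n u) (dyadic m v) w *
          ((phi (enorm (dyadic n u - dyadic m v : 'rV[R]_d)) `^ alpha) `^ gamma)^-1%:E)%E
  else 0%E.

Let Q w := ereal_sup (range (fun n => quot (unpickle n) w)).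

Let measurable_Q : measurable_fun setT Q.
Proof.
have -> : Q = (fun w => esups (fun n => quot (unpickle n) w) 0%N).
  apply/funext => w; rewrite /Q /esups /sdrop /=; congr ereal_sup.
  by apply/seteqP; split => _ [n _ <-]; exists n.
apply: measurable_fun_esups => n; case: (unpickle n) => [[[p u] [m v]]|] /=; last first.
  exact: measurable_cst.
have [_|_] := eqVneq (dyadic p u : 'rV[R]_d) (dyadic m v).
  exact: measurable_cst.
under eq_fun do rewrite muleC; apply: measurable_funeM.
by apply: dist_meas; exact: dyadic_cube.
Qed.

Let quot_le_Q j w : (quot (Some j) w <= Q w)%E.
Proof. by apply: ereal_sup_ubound; exists (pickle j) => //; rewrite pickleK. Qed.

Let Q_ge0 w : (0 <= Q w)%E.
Proof.
have := quot_le_Q ((0%N, [ffun=> 0%N]), (0%N, [ffun=> 0%N])) w.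
by rewrite /= eqxx.
Qed.

Let divr_powR (x y r : R) : 0 <= x -> 0 <= y -> (x / y) `^ r = x `^ r / y `^ r.
Proof.
move=> x0 y0; rewrite powRM ?invr_ge0//.
by rewrite -(powR_inv1 y0) powRAC powR_inv1 ?powR_ge0.
Qed.

Let quot_le_S j w : good w -> (quot j w <= S w)%E.
Proof.
move=> gw; case: j => [[[n u] [m v]]|] /=; last exact: S_ge0.
case: ifP => [_|/negbT pq]; first exact: S_ge0.
set p := dyadic n u in pq *; set q := dyadic m v in pq *.
have r0 : 0 < enorm (p - q) by rewrite enorm_gt0// subr_eq0.
have c0 : 0 < phi (enorm (p - q)) `^ alpha by rewrite powR_gt0// phi_pos.
rewrite lee_pdivrMr ?(powR_gt0 _ c0)//; apply: ge_ereal_sup => _ [t t01 <-].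
rewrite -lee_pdivrMr ?(powR_gt0 _ c0)//.
apply: (@le_trans _ _ (holder_seminorm alpha phi (fun x => Xt t x w) `^ gamma)%E).
  (* At dyadic points [Xt] and [X] coincide on [good], so [dist] there can be read off from [Xt]. *)
  have Xp n' u' : X t (dyadic n' u') w = Xt t (dyadic n' u') w.
    rewrite (congr1 (fun g => g (dyadic n' u')) (Xt_good w t gw)).
    by rewrite (chain_lim_dyadic (U := fun y => X t y w)).
  rewrite /p /q !Xp -EFinM -divr_powR ?powR_ge0// -poweR_EFin.
  apply: poweR_le => //; first by rewrite lee_fin divr_ge0 ?powR_ge0.
  by apply: holder_ub => //; exact: dyadic_cube.
by apply: ereal_sup_ubound; exists t.
Qed.

(** Each Hoelder quotient of [Xt] is the limit of the quotients at grid approximations, because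
    [phi] is continuous at [enorm (x - y) > 0]; the latter are at most [Q w ^ gamma^-1]. *)
Let S_le_Q w : good w -> (S w <= Q w)%E.
Proof.
move=> gw; apply: ge_ereal_sup => _ [t t01 <-].
have -> : Q w = ((Q w `^ gamma^-1) `^ gamma)%E.
  by rewrite -poweRrM mulVf ?gt_eqF// poweRe1.
apply: poweR_le => //; apply: ge_ereal_sup => _ [x [y [cx cy xy ->]]].
have r0 : 0 < enorm (x - y) by rewrite enorm_gt0// subr_eq0.
have cv_r : enorm (dyfloor n x - dyfloor n y) @[n --> \oo] --> enorm (x - y).
  apply: cvg_enorm => i.
  rewrite [X in _ --> X](_ : _ = x ord0 i - y ord0 i); last by rewrite !mxE.
  rewrite (_ : (fun n => _) = (fun n => dyfloor n x ord0 i - dyfloor n y ord0 i));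
    last by apply/funext => n; rewrite !mxE.
  by apply: cvgB; exact: cvg_dyfloor.
have cv_X z : unit_cube z -> X t (dyfloor n z) w @[n --> \oo] --> Xt t z w.
  move=> cz; rewrite (congr1 (fun g => g z) (Xt_good w t gw)).
  exact: (cvg_chain (U := fun y => X t y w) a_gt0 (k_ge0^~ w) (U_step w t gw t01)
    (k_sum w gw)).
pose q n := `|X t (dyfloor n x) w - X t (dyfloor n y) w| /
  phi (enorm (dyfloor n x - dyfloor n y)) `^ alpha.
apply: (@cvge_to_le _ \oo _ R (fun n => (q n)%:E)).
  apply: cvg_EFin; first exact: nearW.
  apply: cvgM; first by apply: cvg_norm; apply: cvgB; exact: cv_X.
  apply: cvgV; first by rewrite gt_eqF// powR_gt0// phi_pos.
  apply: (@continuous_cvg _ _ _ _ _ _ (fun y : R => y `^ alpha)).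
    by apply: continuous_powR; exact: phi_pos.
  by apply: (@continuous_cvg _ _ _ _ _ _ phi) => //; exact: phi_continuous.
near=> n.
have rn0 : 0 < enorm (dyfloor n x - dyfloor n y).
  by near: n; exact: (cvgr_gt _ cv_r).
have c0 : 0 < phi (enorm (dyfloor n x - dyfloor n y)) `^ alpha.
  by rewrite powR_gt0// phi_pos.
have qE : (q n)%:E = (((q n)%:E `^ gamma) `^ gamma^-1)%E.
  by rewrite -poweRrM mulfV ?gt_eqF// poweRe1// lee_fin divr_ge0 ?powR_ge0.
rewrite qE; apply: poweR_le; [exact: ltW|exact: poweR_ge0|].
pose u (z : 'rV[R]_d) : {ffun 'I_d -> nat} := [ffun i => Num.truncn (2 ^+ n * z ord0 i)].
have uE z : dyadic n (u z) = dyfloor n z by apply/rowP => i; rewrite !mxE ffunE.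
apply: le_trans (quot_le_Q ((n, u x), (n, u y)) w) => /=; rewrite !uE.
case: ifP => [/eqP xyn|_].
  suff : 0 < 0 :> R by rewrite ltxx.
  rewrite [ltRHS](_ : _ = enorm (dyfloor n x - dyfloor n y))//.
  by rewrite xyn subrr /enorm big1 ?sqrtr0// => i _; rewrite mxE expr0n.
rewrite /q divr_powR ?powR_ge0// EFinM.
by rewrite lee_wpmul2r ?lee_fin ?invr_ge0 ?powR_ge0//; exact: dist_ub.
Unshelve. all: by end_near. Qed.

Let measurable_S : measurable_fun setT S.
Proof.
(* Off [good] the supremum [Q] may be infinite, but [0 * +oo = 0] and [S] vanishes there. *)
have -> : S = (fun w => (\1_good w)%:E * Q w)%E.
  apply/funext => w; rewrite indicE; have [gw|gw] := pselect (good w).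
    rewrite mem_set// mul1e; apply/eqP; rewrite eq_le S_le_Q//=.
    by apply: ge_ereal_sup => _ [n _ <-]; exact: quot_le_S.
  by rewrite memNset// mul0e S_bad.
apply: emeasurable_funM => //; apply/measurable_EFinP.
exact: measurable_indic.
Qed.

Lemma holder_moment : measurable_fun setT S /\ (\int[P]_w S w < +oo)%E.
Proof.
split=> //; have [c c0 hS] := S_bound.
apply: (@le_lt_trans _ _ (\int[P]_w (c%:E * (A w + 1)))%E).
  apply: ge0_le_integral => //.
  by apply: measurable_funeM; exact: emeasurable_funD.
rewrite ge0_integralZl//; last 2 first.
- exact: emeasurable_funD.
- by move=> w _; rewrite adde_ge0.
rewrite ge0_integralD// integral_cst// mul1e.
apply: lte_mul_pinfty => //.
by rewrite lte_add_pinfty// (le_lt_trans (probability_le1 P _))// ltry.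
Qed.

End Seminorm.

Lemma exists_holder_realization : exists Xt : R -> 'rV[R]_d -> Omega -> H,
  [/\ realization P X Xt, continuous_in_space P Xt &
    forall alpha : R, 0 < alpha <= 1 / gamma - theta ->
      let S := sup_time (fun t w =>
        (holder_seminorm alpha (phi beta f) (fun x => Xt t x w) `^ gamma)%E) in
      measurable_fun [set: Omega] S /\ (\int[P]_w S w < +oo)%E].
Proof.
exists Xt; split; [exact: Xt_realization|exact: Xt_continuous|].
by move=> alpha alphaP; exact: holder_moment.
Qed.

End RandomField.

Theorem corollary1p1 (R : realType) (disp : measure_display)
  (Omega : measurableType disp) (P : probability Omega R)
  (H : completeNormedModType R) (d : nat) (hd : (1 <= d)%N)
  (X : R -> 'rV[R]_d -> Omega -> H) (hX : stochastic_field X)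
  (gamma beta : R) (hgamma : 0 < gamma)
  (hbeta_ge1 : 1 <= gamma -> gamma < beta)
  (hbeta_lt1 : gamma < 1 -> 1 / gamma < beta)
  (f : R -> R)
  (hf_mono : {in `[1 / 2, +oo[ &, {homo f : r s / r <= s}})
  (hf_cont : {within `[1 / 2, +oo[, continuous f})
  (hf_half : f (1 / 2) = ln 2 `^ (- beta))
  (C : R) (hC : 0 < C)
  (hmeas : forall x y, unit_cube x -> unit_cube y ->
     measurable_fun [set: Omega]
       (sup_time (fun t w => (`|X t x w - X t y w| `^ gamma)%:E)))
  (hmoment : forall x y, unit_cube x -> unit_cube y ->
     (\int[P]_w sup_time (fun t w => (`|X t x w - X t y w| `^ gamma)%:E) w
      <= (C * enorm (x - y) ^+ d * phi beta f (enorm (x - y)))%:E)%E)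
  (theta : R)
  (htheta_ge1 : 1 <= gamma -> 1 / beta < theta < 1 / gamma)
  (htheta_lt1 : gamma < 1 -> 1 / (beta * gamma) < theta < 1 / gamma) :
  exists Xt : R -> 'rV[R]_d -> Omega -> H,
    [/\ realization P X Xt,
        continuous_in_space P Xt &
        forall alpha : R, 0 < alpha <= 1 / gamma - theta ->
          let S := sup_time (fun t w =>
            (holder_seminorm alpha (phi beta f) (fun x => Xt t x w)
               `^ gamma)%E) in
          measurable_fun [set: Omega] S /\ (\int[P]_w S w < +oo)%E].
Proof.
have beta0 : 0 < beta.
  have [g1|g1] := ltP gamma 1.
    by apply: lt_trans (hbeta_lt1 g1); rewrite divr_gt0.
  by apply: lt_trans (hbeta_ge1 g1).
have alpha0 : 0 < 1 / gamma - theta.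
  rewrite subr_gt0; have [g1|g1] := ltP gamma 1.
    by case/andP: (htheta_lt1 g1).
  by case/andP: (htheta_ge1 g1).
have [e [K [he K0 hK]]] := exists_hoelder_weight gamma beta theta hgamma
  hbeta_ge1 hbeta_lt1 htheta_ge1 htheta_lt1.
exact: (exists_holder_realization (e := e) (K := K) (C := C)).
Qed.
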